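(* Let $m\ge 4$ and let $1<c_2<c_3<\cdots<c_m$ be natural numbers. If the coin system $\langle 1,c_2,c_3\rangle$ is non-canonical, then the coin system $\langle 1,c_2,c_3,\dots,c_m\rangle$ is also non-canonical.
   Context: A coin system is a tuple $\langle c_1,\dots,c_m\rangle$ of natural numbers with $1=c_1<c_2<\cdots<c_m$. A representation of $x$ is a tuple $(\alpha_1,\dots,\alpha_m)$ of natural numbers with $\sum_i\alpha_ic_i=x$, of size $\sum_i\alpha_i$. The greedy representation $\mathrm{GRD}(x)$ is the representation with $\sum_{j<i}\alpha_jc_j<c_i$ for all $2\le i\le m$; $\mathrm{OPT}(x)$ is a representation of minimum size. The system is canonical if $|\mathrm{GRD}(x)|=|\mathrm{OPT}(x)|$ for all $x$, and non-canonical otherwise. *)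

(* Defs.v *)
From mathcomp Require Import all_boot.

Set Implicit Arguments.
Unset Strict Implicit.
Unset Printing Implicit Defensive.

(* The i-th coin of the mathematical text, i = 1..m, is [tnth c] at index i-1. *)
Definition coin_system (m : nat) (c : m.-tuple nat) : Prop :=
  nth 0 c 0 = 1 /\ sorted ltn c.

Definition representation (m : nat) (c : m.-tuple nat) (x : nat)
    (a : m.-tuple nat) : Prop :=
  \sum_(i < m) tnth a i * tnth c i = x.

Definition rep_size (m : nat) (a : m.-tuple nat) : nat := \sum_(i < m) tnth a i.

(* GRD(x) and OPT(x) are rendered as predicates "a is GRD(x)" and "a is an
   OPT(x)".  Uniqueness and existence of GRD(x) are [greedy_unique] and
   [greedy_exists]; OPT(x) is unique only up to its size. *)
Definition greedy (m : nat) (c : m.-tuple nat) (x : nat)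
    (a : m.-tuple nat) : Prop :=
  representation c x a /\
  forall i : 'I_m, 0 < i ->
    \sum_(j < m | j < i) tnth a j * tnth c j < tnth c i.

Definition optimal (m : nat) (c : m.-tuple nat) (x : nat)
    (a : m.-tuple nat) : Prop :=
  representation c x a /\
  forall b : m.-tuple nat, representation c x b -> rep_size a <= rep_size b.

Definition canonical (m : nat) (c : m.-tuple nat) : Prop :=
  forall (x : nat) (a b : m.-tuple nat),
    greedy c x a -> optimal c x b -> rep_size a = rep_size b.

Definition noncanonical (m : nat) (c : m.-tuple nat) : Prop := ~ canonical c.

Lemma greedy_exists_fun (c : nat -> nat) (n x : nat) :
  c 0 = 1 -> (forall i, 0 < i <= n -> 0 < c i) ->
  exists a : nat -> nat, \sum_(i < n.+1) a i * c i = x /\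
    forall i, 0 < i <= n -> \sum_(j < i) a j * c j < c i.
Proof.
move=> c0; elim: n x => [|n IHn] x c_gt0.
  by exists (fun=> x); split=> [|[]//]; rewrite big_ord1 c0 muln1.
have cn_gt0 : 0 < c n.+1 by apply: c_gt0; rewrite leqnn.
have [|a [aE a_lt]] := IHn (x %% c n.+1).
  by move=> i /andP[i0 lein]; apply: c_gt0; rewrite i0 leqW.
pose b i := if i == n.+1 then x %/ c n.+1 else a i.
have bE i : i <= n.+1 -> \sum_(j < i) b j * c j = \sum_(j < i) a j * c j.
  move=> lei; apply: eq_bigr => j _.
  by rewrite /b (ltn_eqF (leq_trans (ltn_ord j) lei)).
exists b; split=> [|i /andP[i0 lei]].
  by rewrite big_ord_recr /= bE // aE /b eqxx addnC -divn_eq.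
rewrite bE //; case: (ltngtP i n.+1) lei => // [lti _|-> _].
  by apply: a_lt; rewrite i0.
by rewrite aE ltn_mod.
Qed.

Lemma coin_gt0 (m : nat) (c : m.-tuple nat) (i : 'I_m) :
  coin_system c -> 0 < tnth c i.
Proof.
case=> c0 sc; rewrite (tnth_nth 0); case: (posnP i) => [->|i0].
  by rewrite c0.
apply: leq_ltn_trans (leq0n (nth 0 c 0)) _.
by rewrite (sorted_ltn_nth ltn_trans) // inE size_tuple // (ltn_trans i0).
Qed.

Lemma greedy_exists (m : nat) (c : m.-tuple nat) (x : nat) :
  coin_system c -> exists a, greedy c x a.
Proof.
case: m c => [|n] c hc; first by case: hc; rewrite tuple0.
have c_gt0 i : 0 < i <= n -> 0 < nth 0 c i.
  case/andP=> _ lei.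
  by have := coin_gt0 (Ordinal (lei : i < n.+1)) hc; rewrite (tnth_nth 0).
have [a [aE a_lt]] := greedy_exists_fun x hc.1 c_gt0.
exists [tuple a i | i < n.+1]; split=> [|i i0].
  by rewrite -aE; apply: eq_bigr => i _; rewrite tnth_mktuple (tnth_nth 0).
rewrite (tnth_nth 0); apply: leq_trans (a_lt i _); last first.
  by rewrite i0 -ltnS ltn_ord.
rewrite (big_ord_widen n.+1 (fun j => a j * nth 0 c j)) ?(ltnW (ltn_ord i)) // ltnS.
by apply: eq_leq; apply: eq_bigr => j _; rewrite tnth_mktuple (tnth_nth 0).
Qed.

Lemma greedy_unique (m : nat) (c : m.-tuple nat) (x : nat) (a b : m.-tuple nat) :
  coin_system c -> greedy c x a -> greedy c x b -> a = b.
Proof.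
move=> hc [aE a_lt] [bE b_lt].
pose S (d : m.-tuple nat) k := \sum_(j < m | j < k) tnth d j * tnth c j.
have SE d (i : 'I_m) : S d i.+1 = tnth d i * tnth c i + S d i.
  rewrite /S (bigD1 i) //=; congr (_ + _); apply: eq_bigl => j.
  by rewrite ltnS andbC -(inj_eq val_inj) -ltn_neqAle.
have Slt d : (forall i : 'I_m, 0 < i -> S d i < tnth c i) ->
    forall i : 'I_m, S d i < tnth c i.
  move=> d_lt i; case: (posnP i) => [i0|]; last exact: d_lt.
  by rewrite i0 /S big_pred0 ?coin_gt0.
have step (i : 'I_m) : S a i.+1 = S b i.+1 -> tnth a i = tnth b i /\ S a i = S b i.
  rewrite !SE => eqS; have cg := coin_gt0 i hc; split.
    move/(congr1 (divn^~ (tnth c i))): eqS.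
    by rewrite !divnMDl // !divn_small ?addn0 // Slt.
  move/(congr1 (modn^~ (tnth c i))): eqS.
  by rewrite !modnMDl !modn_small // Slt.
have SM d : S d m = \sum_(i < m) tnth d i * tnth c i.
  by apply: eq_bigl => j; rewrite ltn_ord.
have eqS k : k <= m -> S a (m - k) = S b (m - k).
  elim: k => [|k IHk] lekm; first by rewrite subn0 !SM aE bE.
  have ltm : m - k.+1 < m by rewrite ltn_subrL (leq_ltn_trans _ lekm).
  have := step (Ordinal ltm); rewrite /= -subSn // subSS.
  by case/(_ (IHk (ltnW lekm))).
apply: eq_from_tnth => i; apply: (step i _).1.
by rewrite -(subKn (ltn_ord i)) eqS // leq_subr.
Qed.

(* Main.v *)
(* Write c3 = q c2 + r with r < c2.  If r = 0 or c2 <= q + r then exchanging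
   coins for c3 never increases the size, so non-canonicity of <1, c2, c3> gives
   0 < r and q + r < c2.  In a canonical system, an amount x with
   c_i <= x < c_(i+1) payable with k coins leaves x - c_i payable with fewer than
   k coins.  Applied to x = (q+1) c2, this forces c4 <= (q+1) c2, hence
   c4 - c3 < c3 - 1.  Let s be the last index with E = c_(s+1) - c_s < c3 - 1.
   If E = 1, then c_s + c2 = c_(s+1) + (c2 - 1) contradicts canonicity.
   Otherwise c_s + c3 = c_(s+1) + (c3 - E) forces c3 - E to be a coin, namely c2,
   and c_s + q c2 = c_(s+1) + (c2 - r) contradicts canonicity. *)

Require Import Defs.
From mathcomp Require Import all_boot.
From mathcomp Require Import zify.

Set Implicit Arguments.
Unset Strict Implicit.
Unset Printing Implicit Defensive.

(** Induction on [n]: a coin [q * c2 + r] replaces either [q] coins [c2] and [r] ones, or [q + 1]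
    coins [c2] with [c2 - r] ones given back. Neither trade increases the size. *)
Lemma exchange_size_le (c2 q r a1 a2 n b1 b2 : nat) :
  0 < q -> r < c2 -> r = 0 \/ c2 <= q + r -> a1 < c2 ->
  b1 + b2 * c2 = a1 + a2 * c2 + n * (q * c2 + r) -> a1 + a2 + n <= b1 + b2.
Proof.
move=> q0 rc2 hr a1c2; elim: n b1 b2 => [|n IHn] b1 b2 eqb.
  have le_b2 : b2 <= a2 by rewrite leqNgt; apply/negP => lt_a2; nia.
  have := leq_pmulr (a2 - b2) (leq_ltn_trans (leq0n _) rc2).
  by have := leq_mul2r c2 b2 a2; rewrite mulnBl le_b2 orbT; lia.
have c2_gt0 : 0 < c2 by lia.
(* Changing batches of [c2] ones into coins [c2] leaves fewer than [c2] ones, which forces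
   [q <= b2']. *)
set b1' := b1 %% c2; set b2' := b2 + b1 %/ c2.
have lt_b1' : b1' < c2 by rewrite ltn_mod.
have le_b' : b1' + b2' <= b1 + b2.
  by have := divn_eq b1 c2; have := leq_pmulr (b1 %/ c2) c2_gt0; rewrite /b2'; lia.
have eqb' : b1' + b2' * c2 = a1 + a2 * c2 + n.+1 * (q * c2 + r).
  by have := divn_eq b1 c2; rewrite -eqb mulnDl; lia.
apply: leq_trans le_b'; have le_q : q <= b2' by nia.
have [le_r | lt_r] := leqP r b1'.
  have := IHn (b1' - r) (b2' - q); rewrite mulnBl.
  by have := leq_mul2r c2 q b2'; rewrite le_q orbT; lia.
(* Too few ones: [r > 0], so [c2 <= q + r] and giving back [c2 - r] ones is affordable. *)
have lt_q : q < b2' by nia.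
have := IHn (b1' + (c2 - r)) (b2' - q.+1); rewrite mulnBl mulSn.
by have := leq_mul2r c2 q.+1 b2'; rewrite lt_q orbT mulSn; lia.
Qed.

Lemma three_coins_canonical (c2 c3 : nat) :
  1 < c2 -> c2 < c3 -> c3 %% c2 = 0 \/ c2 <= c3 %/ c2 + c3 %% c2 ->
  canonical [tuple 1; c2; c3].
Proof.
move=> c2_gt1 lt23 hr x a b ga [repb optb]; have [repa lta] := ga.
apply/eqP; rewrite eqn_leq optb // andbT.
have lt2 := lta (inord 1); have lt3 := lta (inord 2).
rewrite big_mkcond /= in lt2; rewrite big_mkcond /= in lt3.
move: repa repb lt2 lt3; rewrite /representation /rep_size.
rewrite !big_ord_recl !big_ord0 /= !(tnth_nth 0) /= !inordK //= /bump /=.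
rewrite !addn0 !muln1.
move: (nth 0 a 0) (nth 0 a 1) (nth 0 a 2) (nth 0 b 0) (nth 0 b 1) (nth 0 b 2).
move=> a1 a2 a3 b1 b2 b3 repa repb /(_ isT) lt2 /(_ isT) lt3.
(* The greedy remainder is below [c3], so [a3] is the largest possible count; the [b3] common coins
   cancel. *)
have le3 : b3 <= a3 by nia.
have := @exchange_size_le c2 (c3 %/ c2) (c3 %% c2) a1 a2 (a3 - b3) b1 b2.
rewrite -divn_eq divn_gt0 ?ltn_mod; [|lia].
have ? : b3 * c3 <= a3 * c3 by rewrite leq_mul2r le3 orbT.
rewrite mulnBl; lia.
Qed.

Section Payable.

Variables (m : nat) (c : m.-tuple nat).

Definition payable (x k : nat) : Prop :=
  exists2 d : m.-tuple nat, representation c x d & rep_size d = k.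

Lemma payable0 : payable 0 0.
Proof.
by exists [tuple 0 | _ < m]; rewrite /representation /rep_size big1 // => i _;
   rewrite tnth_mktuple.
Qed.

Lemma payableD (x k n i : nat) :
  i < m -> payable x k -> payable (x + n * nth 0 c i) (k + n).
Proof.
move=> ltim [d dx dk]; pose j := Ordinal ltim.
exists [tuple tnth d l + (if l == j then n else 0) | l < m].
  rewrite /representation -dx; under eq_bigr => l _ do rewrite tnth_mktuple mulnDl.
  rewrite big_split /=; congr (_ + _).
  by rewrite (bigD1 j) //= eqxx big1 ?addn0 ?(tnth_nth 0) // => l /negPf->.
rewrite /rep_size -dk; under eq_bigr => l _ do rewrite tnth_mktuple.
by rewrite big_split /= -big_mkcond big_pred1_eq.
Qed.

Lemma payable_remove (d : m.-tuple nat) (x : nat) (i : 'I_m) :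
  representation c x d -> 0 < tnth d i ->
  exists2 k, k.+1 = rep_size d & payable (x - tnth c i) k.
Proof.
move=> dx di; exists (rep_size d).-1.
  by rewrite prednK // /rep_size (bigD1 i) //= ltn_addr.
exists [tuple tnth d l - (l == i) | l < m].
  rewrite /representation -dx !(bigD1 (P := xpredT) i) //= tnth_mktuple eqxx.
  rewrite mulnBl mul1n addnBAC ?leq_pmull //; congr (_ + _ - _).
  by apply: eq_bigr => l /negPf nl; rewrite tnth_mktuple nl subn0.
rewrite /rep_size !(bigD1 (P := xpredT) i) //= tnth_mktuple eqxx.
rewrite -subn1 -addnBAC //; congr (_ + _).
by apply: eq_bigr => l /negPf nl; rewrite tnth_mktuple nl subn0.
Qed.

Lemma payable_size0 (x : nat) : payable x 0 -> x = 0.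
Proof.
case=> d <- /eqP; rewrite sum_nat_eq0 => /forallP d0.
by rewrite big1 // => i _; rewrite (eqP (d0 i)).
Qed.

Lemma payable_size_le1 (x k : nat) :
  payable x k -> k <= 1 -> 0 < x -> exists2 i, i < m & x = nth 0 c i.
Proof.
case=> d dx <- le1 x_gt0.
have [i di] : exists i, 0 < tnth d i.
  apply/existsP; apply: contraTT x_gt0; rewrite negb_exists => /forallP d0.
  rewrite -dx big1 // => i _.
  by move: (d0 i); rewrite -eqn0Ngt => /eqP->.
have [k' k'E pk'] := payable_remove dx di.
have le_x : tnth c i <= x.
  by rewrite -dx (bigD1 i) //=; apply: leq_trans (leq_addr _ _); rewrite leq_pmull.
have k'0 : k' = 0 by lia.
rewrite k'0 in pk'; have := payable_size0 pk'.
by exists i; rewrite // -tnth_nth; lia.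
Qed.

Hypothesis coins : coin_system c.

Lemma coins_nth_lt (i j : nat) : i < j < m -> nth 0 c i < nth 0 c j.
Proof.
case/andP=> ltij ltjm; rewrite (sorted_ltn_nth ltn_trans) ?coins.2 //.
  by rewrite inE size_tuple (ltn_trans ltij).
by rewrite inE size_tuple.
Qed.

Lemma coins_nth_le (i j : nat) : i <= j -> j < m -> nth 0 c i <= nth 0 c j.
Proof.
rewrite leq_eqVlt => /orP[/eqP->//|ltij] ltjm.
by apply/ltnW/coins_nth_lt; rewrite ltij.
Qed.

(** Only ones fit into an amount below the second coin. Each final contradiction comes from this
    bound. *)
Lemma payable_small (x k : nat) : x < nth 0 c 1 -> payable x k -> x <= k.
Proof.
move=> ltx [d dx <-]; rewrite -dx; apply: leq_sum => i _.
have [->//|di] := posnP (tnth d i).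
have [i0|i0] := posnP i; first by rewrite (tnth_nth 0 c) i0 coins.1 muln1.
have : tnth c i <= x.
  by rewrite -dx (bigD1 i) //=; apply: leq_trans (leq_addr _ _); rewrite leq_pmull.
rewrite (tnth_nth 0 c) leqNgt (leq_trans ltx) //.
exact: coins_nth_le.
Qed.

Hypothesis can : canonical c.

(** Canonicity mentions optimal representations only. A representation shorter than the greedy one
    would, by descent on its size, lead to an optimal one that is shorter too. *)
Lemma greedy_size_le (x : nat) (a b : m.-tuple nat) :
  greedy c x a -> representation c x b -> rep_size a <= rep_size b.
Proof.
move=> ga; have [n] := ubnP (rep_size b); elim: n b => // n IHn b ltbn bx.
rewrite leqNgt; apply/negP => ltba.
suff bopt : optimal c x b by move: ltba; rewrite (can ga bopt) ltnn.
split=> // b' b'x; rewrite leqNgt; apply/negP => ltb'b.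
have := IHn b' (leq_trans ltb'b ltbn) b'x; lia.
Qed.

(** Coins above [i] exceed [x]; without coin [i], all of [x] would lie in the partial sum that
    greediness keeps below [tnth c i]. *)
Lemma greedy_uses_coin (x : nat) (a : m.-tuple nat) (i : 'I_m) :
  greedy c x a -> 0 < i -> tnth c i <= x ->
  (forall j, i < j < m -> x < nth 0 c j) -> 0 < tnth a i.
Proof.
move=> [ax a_lt] i_gt0 leix ltx; rewrite lt0n; apply/eqP => ai0.
have := a_lt i i_gt0; rewrite ltnNge; apply/negP/negPn.
apply: leq_trans leix _; rewrite -{1}ax [leqRHS]big_mkcond /=; apply: leq_sum => j _.
case: (ltngtP j i) => // [ltij|/val_inj->]; last by rewrite ai0.
rewrite leqn0 muln_eq0 -[_ || _]negbK negb_or -!lt0n; apply/negP => /andP[aj0 _].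
have := ltx j; rewrite ltij ltn_ord -(tnth_nth 0) => /(_ isT).
rewrite ltnNge -ax (bigD1 j) //=.
by rewrite (leq_trans _ (leq_addr _ _)) // leq_pmull.
Qed.

(** The greedy representation has size at most [k] and contains coin [i]; one copy is removed. *)
Lemma canonical_payable_sub (x k i : nat) :
  payable x k -> 0 < i < m -> nth 0 c i <= x ->
  (forall j, i < j < m -> x < nth 0 c j) ->
  exists2 k', k' < k & payable (x - nth 0 c i) k'.
Proof.
move=> [b bx <-] /andP[i_gt0 ltim] leix ltx.
have [a ga] := greedy_exists x coins.
pose j := Ordinal ltim; have cj : tnth c j = nth 0 c i by rewrite (tnth_nth 0).
have aj : 0 < tnth a j by apply: (greedy_uses_coin ga); rewrite ?cj.
have [k' k'E pk'] := payable_remove ga.1 aj.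
by exists k'; rewrite ?k'E ?(greedy_size_le ga) // -cj.
Qed.

End Payable.

Theorem theorem7 (m : nat) (hm : 4 <= m) (c : m.-tuple nat) (hc : coin_system c)
    (h3 : noncanonical [tuple 1; nth 0 c 1; nth 0 c 2]) :
  noncanonical c.
Proof.
move=> can.
have c2_gt1 : 1 < nth 0 c 1 by rewrite -[X in X < _]hc.1; apply: coins_nth_lt => //; lia.
have lt23 : nth 0 c 1 < nth 0 c 2 by apply: coins_nth_lt => //; lia.
have lt34 : nth 0 c 2 < nth 0 c 3 by apply: coins_nth_lt => //; lia.
have c3E := divn_eq (nth 0 c 2) (nth 0 c 1).
set q := _ %/ _ in c3E; set r := _ %% _ in c3E.
have q_gt0 : 0 < q by rewrite divn_gt0; lia.
have r_lt : r < nth 0 c 1 by rewrite ltn_mod; lia.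
have [r_gt0 lt_qr] : 0 < r /\ q + r < nth 0 c 1.
  apply/andP; apply/negPn/negP; rewrite negb_and -leqNgt -leqNgt leqn0.
  move=> hr; apply: h3; apply: three_coins_canonical => //.
  by case/orP: hr => [/eqP|]; [left | right].
have no_small y k : payable c y k -> y < nth 0 c 1 -> k < y -> False.
  by move=> py lty; have := payable_small hc lty py; lia.
(* Otherwise subtracting the third coin leaves [c2 - r], payable with at most [q] coins although
   [q < c2 - r]. *)
have c4_le : nth 0 c 3 <= q.+1 * nth 0 c 1.
  rewrite leqNgt; apply/negP => lt4.
  have px : payable c (q.+1 * nth 0 c 1) q.+1.
    by apply: (payableD q.+1 _ (payable0 c)); lia.
  have [||j /andP[lt2j ltjm]|k ltk pk] := canonical_payable_sub hc can px (i := 2).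
  - lia.
  - by rewrite mulSn; lia.
  - exact: leq_trans lt4 (coins_nth_le hc lt2j ltjm).
  by apply: (no_small _ _ pk); rewrite mulSn; lia.
(* Indices are zero-based: [s = 2] is the gap between the third and fourth coins. *)
pose P s := [&& 2 <= s, s.+1 < m & (nth 0 c s.+1 - nth 0 c s).+1 < nth 0 c 2].
have exP : exists s, P s by exists 2; apply/and3P; split=> //; rewrite mulSn in c4_le; lia.
have P_le s : P s -> s <= m by rewrite /P; lia.
have [s /and3P[s_ge2 ltsm gap] smax] := ex_maxnP exP P_le.
have lt_s : nth 0 c s < nth 0 c s.+1 by apply: coins_nth_lt => //; lia.
(* By maximality of [s], any gap just after coin [s.+1] is at least [c3 - 1]. *)
have next y : y.+1 < nth 0 c 2 -> forall j, s.+1 < j < m -> nth 0 c s.+1 + y < nth 0 c j.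
  move=> lty j /andP[ltsj ltjm]; have lt_ss : s.+2 < m by lia.
  apply: leq_trans (coins_nth_le hc ltsj ltjm).
  by have := smax s.+1; rewrite /P ltnn lt_ss; lia.
have pay_sub y n i : i < m -> nth 0 c s + n * nth 0 c i = nth 0 c s.+1 + y ->
    y.+1 < nth 0 c 2 -> exists2 k, k <= n & payable c y k.
  move=> ltim xE lty.
  have ps : payable c (nth 0 c s + n * nth 0 c i) n.+1.
    have := payableD 1 (ltnW ltsm) (payable0 c).
    by rewrite mul1n => /(payableD n ltim).
  rewrite xE in ps.
  have [||j hj|k ltk] := canonical_payable_sub hc can ps (i := s.+1).
  - lia.
  - by rewrite leq_addr.
  - exact: next hj.
  by rewrite addKn; exists k.
have [E1|E_neq1] := eqVneq (nth 0 c s.+1) (nth 0 c s).+1.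
  (* At most one coin would pay [c2 - 1], which is at least 2 since [0 < q], [0 < r] and
     [q + r < c2]. *)
  have [|||k lek pk] := pay_sub (nth 0 c 1).-1 1 1; [lia..|].
  by apply: (no_small _ _ pk); lia.
have [|||k lek pk] := pay_sub (nth 0 c 2 - (nth 0 c s.+1 - nth 0 c s)) 1 2; [lia..|].
have [//||i ltim iE] := payable_size_le1 pk; first by lia.
(* The amount [c3 - E] exceeds 1 by the choice of [s] and is below [c3], so only [c2] remains. *)
have i1 : i = 1.
  case: i ltim iE => [|[|i]] ltim; rewrite ?hc.1 //; first by lia.
  by have := coins_nth_le hc (isT : 2 <= i.+2) ltim; lia.
rewrite {}i1 in iE.
(* Now [E = c3 - c2], hence [q * c2 - E = c2 - r], again more than [q]. *)
have [|||k' lek' pk'] := pay_sub (nth 0 c 1 - r) q 1; [lia..|].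
by apply: (no_small _ _ pk'); lia.
Qed.
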